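(* Let $n=2k+1$ be odd and let $(s,\pi,L,U)$ be an admissible quadruple. Then $(s,\pi,L,U)$ encodes a feasible basis if and only if the following conditions are satisfied: (i) $|U|=k-1$ and $|L|=k$; (ii) $\pi(s)\in U$; (iii) $s-1\in R=\{1\}$; (iv) $i^*(\pi,L,U)=n$.
   Context: Let $K_n$ be the complete digraph on $V=[n]$ (all arcs $(i,j)$, $i\neq j$). For $\beta\in(0,1)$, $\mathcal{WH}_\beta(K_n)$ is the set of $(x,y)$, $x=(x_{ij})_{i\neq j}$, $y=(y_i)_{i\neq1}$, with (1) $\sum_{j\neq1}x_{1j}-\beta\sum_{j\neq1}x_{j1}=1-\beta^n$; (2) $\sum_{j\neq i}x_{ij}-\beta\sum_{j\neq i}x_{ji}=0$ for $i\in V\setminus\{1\}$; (3) $\sum_{j\neq1}x_{1j}=1$; (4) $\sum_{j\neq i}x_{ij}-y_i=\beta^{n-1}$ for $i\in V\setminus\{1\}$; (5) $0\leq y_i\leq\beta-\beta^{n-1}$ for $i\in V\setminus\{1\}$; (6) $x_{ij}\geq0$ for $i\neq j$. Indices $i\pm1,i\pm2$ are taken modulo $n$ in $[n]$. An admissible quadruple $(s,\pi,L,U)$ consists of a node $s\in\{2,\dots,n\}$, a fixed-point free permutation $\pi$ of $[n]$ such that $\pi(i)=i+1$ if and only if $i=s-1$, and a partition $[n]=\{1,s\}\cup L\cup U$ (disjoint from $\{1,s\}$; $L,U$ possibly empty). It encodes the basis $(B,L,U)$ with basic variables $y_s$, $x_{i\,\pi(i)}$ for $i\in[n]$, and $x_{i\,\pi(i-1)}$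 for $i\in[n]\setminus\{s\}$. The associated basic solution is the unique solution of (1)–(4) in which all non-basic $x$-variables are $0$, $y_i=0$ for $i\in L$ and $y_i=\beta-\beta^{n-1}$ for $i\in U$. The basis is called feasible if this solution satisfies (5) and (6) for all $\beta<1$ sufficiently close to $1$ (feasibility does not depend on $\beta$ for $\beta$ sufficiently close to $1$). Put $R=\{1\}$ and, for $P,Q\in\{L,U,R\}$, $W_{PQ}=\{i\in[n]\setminus\{s\}: i\in P,\ \pi(i)\in Q\}$. For $i\in[n]\setminus\{s,s-1\}$, $I(i)=\{s+1,\dots,i\}$ if $s+1\leq i\leq n$, and $I(i)=\{s+1,\dots,n,1,2,\dots,i\}$ if $1\leq i\leq s-2$; and $N_{PQ}(i)=|I(i)\cap W_{PQ}|$. If $s-1\in R\cup U$ and $\pi(s)\in U$, then there is a unique index $i^*=i^*(\pi,L,U)\in[n]\setminus\{s,s-1\}$ such that $N_{UL}(i^* )+N_{UR}(i^* )+N_{RL}(i^* )=N_{LU}(i^* )+1$ and $N_{UL}(i)+N_{UR}(i)+N_{RL}(i)\leq N_{LU}(i)$ for all $i\in I(i^* )\setminus\{i^*\}$. (Condition (iv) is only considered when (ii) and (iii) hold.) *)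

(* Defs.v *)
From HB Require Import structures.
From mathcomp Require Import all_boot all_order all_algebra perm.
From mathcomp Require Import all_classical all_reals all_analysis.
From mathcomp Require Import zify ring lra.
Set Implicit Arguments.
Unset Strict Implicit.
Unset Printing Implicit Defensive.
Import Order.TTheory GRing.Theory Num.Theory.
Import numFieldNormedType.Exports.
Local Open Scope ring_scope.

(* The digraph has n = m.+1 nodes, and node i of [n] = {1, .., n} is the ordinal
   of value i - 1: node 1 is ord0, node n is ord_max, and the cyclic neighbours
   i + 1 and i - 1 are ordS i and ord_pred i.

   A point (x, y) is a pair of functions x : 'I_m.+1 -> 'I_m.+1 -> R and
   y : 'I_m.+1 -> R; the values x i i and y ord0 are not variables of the
   polytope WH_beta(K_n), and its equations and bounds do not involve them. *)

Definition outflow (R : realType) (m : nat) (x : 'I_m.+1 -> 'I_m.+1 -> R)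
    (i : 'I_m.+1) : R := \sum_(j | j != i) x i j.

Definition inflow (R : realType) (m : nat) (x : 'I_m.+1 -> 'I_m.+1 -> R)
    (i : 'I_m.+1) : R := \sum_(j | j != i) x j i.

Definition WH_equations (R : realType) (m : nat) (beta : R)
    (x : 'I_m.+1 -> 'I_m.+1 -> R) (y : 'I_m.+1 -> R) : Prop :=
  [/\ outflow x ord0 - beta * inflow x ord0 = 1 - beta ^+ m.+1,
      forall i, i != ord0 -> outflow x i - beta * inflow x i = 0,
      outflow x ord0 = 1
    & forall i, i != ord0 -> outflow x i - y i = beta ^+ m].

Definition WH_bounds (R : realType) (m : nat) (beta : R)
    (x : 'I_m.+1 -> 'I_m.+1 -> R) (y : 'I_m.+1 -> R) : Prop :=
  (forall i, i != ord0 -> 0 <= y i <= beta - beta ^+ m) /\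
  (forall i j, i != j -> 0 <= x i j).

Definition admissible (m : nat) (s : 'I_m.+1) (pi : {perm 'I_m.+1})
    (L U : {set 'I_m.+1}) : Prop :=
  [/\ s != ord0,
      forall i, pi i != i,
      forall i, (pi i == ordS i) = (i == ord_pred s),
      [disjoint L & U]
    & L :|: U = ~: [set ord0; s]].

Definition basic_arc (m : nat) (s : 'I_m.+1) (pi : {perm 'I_m.+1})
    (i j : 'I_m.+1) : bool :=
  (j == pi i) || (i != s) && (j == pi (ord_pred i)).

(* When (s, pi, L, U) is admissible no pair (i, i) is a basic arc, so the first
   clause also normalises the unused diagonal entries to 0. *)
Definition basic_solution (R : realType) (m : nat) (beta : R) (s : 'I_m.+1)
    (pi : {perm 'I_m.+1}) (L U : {set 'I_m.+1})
    (x : 'I_m.+1 -> 'I_m.+1 -> R) (y : 'I_m.+1 -> R) : Prop :=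
  [/\ forall i j, ~~ basic_arc s pi i j -> x i j = 0,
      forall i, i \in L -> y i = 0,
      forall i, i \in U -> y i = beta - beta ^+ m
    & WH_equations beta x y].

(* For 0 < beta < 1 the basic solution is unique, so the existential refers to
   that solution: see basic_solution_unique below. *)
Definition feasible_basis (R : realType) (m : nat) (s : 'I_m.+1)
    (pi : {perm 'I_m.+1}) (L U : {set 'I_m.+1}) : Prop :=
  \forall beta \near at_left (1 : R),
    exists (x : 'I_m.+1 -> 'I_m.+1 -> R) (y : 'I_m.+1 -> R),
      basic_solution beta s pi L U x y /\ WH_bounds beta x y.

Definition Rset (m : nat) : {set 'I_m.+1} := [set ord0].

Definition W (m : nat) (s : 'I_m.+1) (pi : {perm 'I_m.+1})
    (P Q : {set 'I_m.+1}) : {set 'I_m.+1} :=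
  [set i | [&& i != s, i \in P & pi i \in Q]].

(* Only meaningful for i different from s and s - 1. *)
Definition cyc_interval (m : nat) (s i : 'I_m.+1) : {set 'I_m.+1} :=
  if (s < i)%N then [set j : 'I_m.+1 | (s < j <= i)%N]
  else [set j : 'I_m.+1 | (s < j)%N || (j <= i)%N].

Definition N (m : nat) (s : 'I_m.+1) (pi : {perm 'I_m.+1})
    (P Q : {set 'I_m.+1}) (i : 'I_m.+1) : nat :=
  #|cyc_interval s i :&: W s pi P Q|.

Definition is_istar (m : nat) (s : 'I_m.+1) (pi : {perm 'I_m.+1})
    (L U : {set 'I_m.+1}) (i : 'I_m.+1) : bool :=
  let Rm := Rset m in
  [&& i != s, i != ord_pred s,
      N s pi U L i + N s pi U Rm i + N s pi Rm L i == N s pi L U i + 1 &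
      [forall j in cyc_interval s i :\ i,
         N s pi U L j + N s pi U Rm j + N s pi Rm L j <= N s pi L U j]]%N.

(* None when there is no such index; when there is one it is unique, see
   is_istar_unique below. *)
Definition istar (m : nat) (s : 'I_m.+1) (pi : {perm 'I_m.+1})
    (L U : {set 'I_m.+1}) : option 'I_m.+1 :=
  [pick i | is_istar s pi L U i].

Lemma is_istar_unique (m : nat) (s : 'I_m.+1) (pi : {perm 'I_m.+1})
    (L U : {set 'I_m.+1}) (i i' : 'I_m.+1) :
  is_istar s pi L U i -> is_istar s pi L U i' -> i = i'.
Proof.
move=> /and4P[si _ /eqP ei /forallP hi] /and4P[si' _ /eqP ei' /forallP hi'].
apply/eqP/negPn/negP => ii'.
have := hi' i; have := hi i'.
rewrite !in_setD1 ii' eq_sym ii' /= ei ei' !addn1 !ltnn !implybF.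
rewrite /cyc_interval -!(inj_eq val_inj) /= in si si' ii' *.
by case: (ltnP s i) => h1; case: (ltnP s i') => h2; rewrite !inE;
  move: si si' ii'; case: (ltngtP i i') => //; rewrite ?h1 ?h2 ?andbT ?orbT //;
  lia.
Qed.

Lemma basic_solution_unique (R : realType) (m : nat) (beta : R) (s : 'I_m.+1)
    (pi : {perm 'I_m.+1}) (L U : {set 'I_m.+1})
    (x x' : 'I_m.+1 -> 'I_m.+1 -> R) (y y' : 'I_m.+1 -> R) :
  0 < beta < 1 -> admissible s pi L U ->
  basic_solution beta s pi L U x y -> basic_solution beta s pi L U x' y' ->
  (forall i j, x i j = x' i j) /\ (forall i, i != ord0 -> y i = y' i).
Proof.
move=> /andP[b0 b1] [s0 fpf succ _ LU].
move=> [x0 yL yU [e1 e2 e3 e4]] [x0' yL' yU' [e1' e2' e3' e4']].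
have nb i : ~~ basic_arc s pi i i.
  rewrite /basic_arc eq_sym (negbTE (fpf i)) /=.
  apply/negP => /andP[/negP ns /eqP h]; apply: ns.
  have := succ (ord_pred i); rewrite -h ord_predK eqxx => /esym /eqP h'.
  by rewrite -(ord_predK i) h' ord_predK.
pose D i j := x i j - x' i j.
have D0 i j : ~~ basic_arc s pi i j -> D i j = 0.
  by move=> h; rewrite /D x0 // x0' // subrr.
pose r i := \sum_j D i j; pose c i := \sum_j D j i.
have rE i : r i = outflow x i - outflow x' i.
  rewrite /r (bigD1 i) //= D0 ?nb // add0r /outflow -sumrB.
  exact: eq_bigr.
have cE i : c i = inflow x i - inflow x' i.
  rewrite /c (bigD1 i) //= D0 ?nb // add0r /inflow -sumrB.
  exact: eq_bigr.
have rc i : r i = beta * c i.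
  rewrite rE cE mulrBr; apply/eqP; rewrite -subr_eq0; apply/eqP.
  case: (eqVneq i ord0) => [-> | i0].
    transitivity ((outflow x ord0 - beta * inflow x ord0) -
                  (outflow x' ord0 - beta * inflow x' ord0)); first by ring.
    by rewrite e1 e1' subrr.
  transitivity ((outflow x i - beta * inflow x i) -
                (outflow x' i - beta * inflow x' i)); first by ring.
  by rewrite e2 // e2' // subrr.
have ryE i : i != ord0 -> r i = y i - y' i.
  by move=> i0; rewrite rE; have := e4 i i0; have := e4' i i0; lra.
have r0 i : i != s -> r i = 0.
  move=> ins; case: (eqVneq i ord0) => [-> | i0]; first by rewrite rE e3 e3' subrr.
  rewrite ryE //.
  have : i \in L :|: U by rewrite LU !inE negb_or i0 ins.
  rewrite inE => /orP[h|h]; first by rewrite (yL _ h) (yL' _ h) subrr.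
  by rewrite (yU _ h) (yU' _ h) subrr.
have rsum : \sum_i r i = r s.
  by rewrite (bigD1 s) //= big1 ?addr0 // => i; apply: r0.
have rs : r s = 0.
  have h : r s = beta * r s.
    rewrite -{1}rsum (eq_bigr _ (fun i _ => rc i)) -mulr_sumr -rsum.
    by congr (_ * _); rewrite /c /r exchange_big.
  have : (1 - beta) * r s = 0 by rewrite mulrBl mul1r -h subrr.
  by move/eqP; rewrite mulf_eq0 subr_eq0 gt_eqF //= => /eqP.
have {r0 rs rsum} r0 i : r i = 0 by case: (eqVneq i s) => [-> | /r0].
have c0 i : c i = 0.
  have /esym/eqP := rc i; rewrite r0 mulf_eq0 gt_eqF //=; exact/eqP.
have row_s : D s (pi s) = 0.
  rewrite -(r0 s) /r (bigD1 (pi s)) //= big1 ?addr0 // => j js.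
  by apply: D0; rewrite /basic_arc (negbTE js) eqxx.
have predS_neq (i : 'I_m.+1) : ord_pred i != i.
  apply/eqP => h; have := congr1 val (ord_predK i); rewrite h /=.
  have m0 : (0 < m)%N.
    rewrite lt0n; apply: contra_neq s0 => m0; apply: val_inj => /=.
    by have := ltn_ord s; rewrite [X in (_ < X.+1)%N]m0 ltnS leqn0 => /eqP.
  have := ltn_ord i; rewrite ltnS leq_eqVlt => /orP[/eqP im | im].
    by rewrite im modnn => m0'; rewrite -m0' in m0.
  by rewrite modn_small ?ltnS // => /eqP; rewrite gtn_eqF.
have row i : i != s -> D i (pi i) + D i (pi (ord_pred i)) = 0.
  move=> ins; rewrite -(r0 i) /r (bigD1 (pi i)) //=.
  rewrite (bigD1 (pi (ord_pred i))) ?(inj_eq perm_inj) ?predS_neq //=.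
  rewrite big1 ?addr0 // => j /andP[j1 j2].
  by apply: D0; rewrite /basic_arc (negbTE j1) (negbTE j2) andbF.
have col i : ordS i != s -> D i (pi i) + D (ordS i) (pi i) = 0.
  move=> ins; rewrite -(c0 (pi i)) /c (bigD1 i) //=.
  have ne : ordS i != i.
    by have := predS_neq (ordS i); rewrite ordSK eq_sym.
  rewrite (bigD1 (ordS i)) //= big1 ?addr0 // => j /andP[j1 j2].
  apply: D0; rewrite /basic_arc !(inj_eq perm_inj) eq_sym (negbTE j1) /=.
  rewrite negb_and; apply/orP; right; apply/eqP => h.
  by move: j2; rewrite h ord_predK eqxx.
have step i : D i (pi i) = 0 -> D (ordS i) (pi (ordS i)) = 0.
  move=> h; case: (eqVneq (ordS i) s) => [-> // | ns].
  have h2 := col i ns; rewrite h add0r in h2.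
  by have := row _ ns; rewrite ordSK h2 addr0.
have iterE t (i : 'I_m.+1) : val (iter t (@ordS _) i) = ((i + t) %% m.+1)%N.
  elim: t => [|t IH]; first by rewrite addn0 modn_small.
  by rewrite iterS /= IH addnS -addn1 modnDml addn1.
have diag i : D i (pi i) = 0.
  have -> : i = iter (i + m.+1 - s) (@ordS _) s.
    apply: val_inj; rewrite iterE subnKC; last first.
      by rewrite (leq_trans (ltnW (ltn_ord s))) // leq_addl.
    by rewrite modnDr modn_small.
  by elim: (_ - _)%N => //= t IH; apply: step.
split=> [i j|i i0]; last by apply/eqP; rewrite -subr_eq0 -ryE // r0.
apply/eqP; rewrite -subr_eq0 -/(D i j); apply/eqP.
have [/orP[/eqP->|/andP[ns /eqP->]]|/D0//] := boolP (basic_arc s pi i j).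
  exact: diag.
by have := row i ns; rewrite diag add0r.
Qed.

(* Main.v *)
Require Import Defs.
From mathcomp Require Import all_boot all_order all_algebra perm.
From mathcomp Require Import all_classical all_reals all_analysis.
From mathcomp Require Import zify ring lra.

(** Write n = m + 1.  In a basic solution every node j has a prescribed inflow
    c_j and outflow r_j: they are read off y_j when j lies in L or U, and off
    the first and third equations when j = 1, while c_s is the value that makes
    total inflow and total outflow agree.  Walking along s, s + 1, s + 2, ...
    the basic arcs form a path in which the arcs i -> pi i and i + 1 -> pi i
    share a head and the arcs i -> pi (i - 1) and i -> pi i share a tail, so
    the values on the arcs i -> pi (i - 1) are partial sums
      b_i = sum over j = s, ..., i - 1 (cyclically) of c_(pi j) - r_j,
    and those on i -> pi i are r_i - b_i.  Everything is a polynomial in the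
    discount factor.  At 1 all c_j and r_j equal 1, hence every b_i vanishes
    and every r_i - b_i equals 1; only the bounds b_i >= 0 and the bounds on y_s
    matter, and a polynomial that vanishes at 1 is positive just below 1 when
    its derivative there (its slope) is negative.

    The slope of c_s is (m - 1)(k - |L|).  The bounds on y_s leave only
    |L| = k and |L| = k - 1 at first order, and the second is excluded because
    2 (1 + x + ... + x^(m-1)) < m (1 + x^(m-1)) for 0 <= x < 1 and m > 2
    (card_L_of_bounds).  With
    |L| = k the inequality b_(s+1) >= 0 forces pi s into U (pi_s_in_U), and
    b_(s-1) = r_(s-1) - c_s >= 0 forces s - 1 = 1 (pred_s_eq0).  For the
    other i, slope_back_ordS gives the slope of b_(i+1) as
      -1 - |I(i)| + e + (m - 1)(N_UL + N_UR + N_RL - N_LU)(i),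
    where e is 1 if I(i) contains the preimage of node 1 under pi and 0
    otherwise.  As |I(i)| is at most m - 2 for i < n, the last factor decides
    the sign: the slope is negative if it is at most 0 and positive if it is at
    least 1 (slope_back_lt0, slope_back_gt0); a slope 0 would require
    pi n = 1 = n + 1, which admissibility forbids.  At i = n the factor is
    always 1 (balance_max), and b_1 = 1 - c_s >= 0 holds by the inequality
    above (inflow_s_le1).  So all b_i >= 0 says precisely that the first i with
    factor 1 is n. *)

Section FeasibleBases.
Set Implicit Arguments.
Unset Strict Implicit.
Import Order.TTheory GRing.Theory Num.Theory.
Import numFieldNormedType.Exports.
Local Open Scope ring_scope.

(** * Signs of polynomials to the left of 1 *)

Section SignsNearOne.
Variable R : realType.
Implicit Type p q : {poly R}.

(** For a polynomial vanishing at 1, a negative slope means positive values just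
    below 1 and a positive slope negative ones. *)
Definition slope p : R := p^`().[1].

Lemma slopeD p q : slope (p + q) = slope p + slope q.
Proof. by rewrite /slope derivD hornerD. Qed.

Lemma slopeB p q : slope (p - q) = slope p - slope q.
Proof. by rewrite /slope derivB hornerD hornerN. Qed.

Lemma slope1 : slope 1 = 0.
Proof. by rewrite /slope derivC horner0. Qed.

Lemma slopeXn n : slope 'X^n = n%:R.
Proof. by rewrite /slope derivXn hornerMn hornerXn expr1n. Qed.

Lemma slopeXM p : slope ('X * p) = p.[1] + slope p.
Proof. by rewrite /slope derivM derivX mul1r hornerD hornerM hornerX mul1r. Qed.

Lemma slope_sum (I : Type) (r : seq I) (P : pred I) (F : I -> {poly R}) :
  slope (\sum_(i <- r | P i) F i) = \sum_(i <- r | P i) slope (F i).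
Proof.
rewrite /slope; apply: (big_morph (fun p : {poly R} => p^`().[1])).
  exact: slopeD.
by rewrite deriv0 horner0.
Qed.

Lemma horner1_Xn n : ('X^n : {poly R}).[1] = 1.
Proof. by rewrite hornerXn expr1n. Qed.

Lemma near_horner_gt0 p :
  0 < p.[1] -> \forall b \near at_left (1 : R), 0 < p.[b].
Proof.
move=> p0; apply: (@cvgr_gt _ _ _ _ _ p.[1]) => //.
exact/cvg_at_left_filter/continuous_horner.
Qed.

(** Dividing by X - 1, which is negative to the left of 1, leaves a polynomial
    whose value at 1 is the slope. *)
Lemma near_horner_slope p : p.[1] = 0 -> slope p < 0 ->
  \forall b \near at_left (1 : R), 0 < p.[b].
Proof.
move=> p1; have /factor_theorem[q ->] : root p 1 by apply/eqP.
rewrite /slope derivM derivXsubC mulr1 hornerD hornerM hornerXsubC subrr mulr0.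
rewrite add0r => q1.
have : 0 < (- q).[1] by rewrite hornerN oppr_gt0.
move/near_horner_gt0 => nq; near=> b.
have b1 : b < 1 by near: b; exact: nbhs_left_lt.
have qb : 0 < (- q).[b] by near: b.
by rewrite hornerM hornerXsubC nmulr_rgt0 ?subr_lt0 // -oppr_gt0 -hornerN.
Unshelve. all: by end_near. Qed.

Lemma slope_le0_of_near p : p.[1] = 0 ->
  (\forall b \near at_left (1 : R), 0 <= p.[b]) -> slope p <= 0.
Proof.
move=> p1 pge; rewrite leNgt; apply/negP => sp.
have /near_horner_slope : (- p).[1] = 0 by rewrite hornerN p1 oppr0.
have -> : slope (- p) = - slope p by rewrite /slope derivN hornerN.
rewrite oppr_lt0 => /(_ sp) plt.
have [b [ge lt]] := filter_ex (filterI pge plt).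
by move: lt; rewrite hornerN oppr_gt0 ltNge ge.
Qed.

End SignsNearOne.

(** * The associated basic solution as polynomials in the discount factor *)

Section BasicSolution.
Variables (R : realType) (m : nat) (s : 'I_m.+1) (pi : {perm 'I_m.+1}).
Variables (L U : {set 'I_m.+1}).

(** The value at s is what total inflow = total outflow forces, after division
    by 1 - X. *)
Definition inflow_poly (i : 'I_m.+1) : {poly R} :=
  if i == s then \sum_(j < m) 'X^j - 'X^(m.-1) *+ #|L| - 1 *+ #|U|
  else if i \in L then 'X^(m.-1) else if i \in U then 1 else 'X^m.

Definition outflow_poly (i : 'I_m.+1) : {poly R} :=
  if i == ord0 then 1 else 'X * inflow_poly i.

(** The nodes s, s + 1, ..., i - 1 in cyclic order; empty when i = s. *)
Definition cyc_prefix (i : 'I_m.+1) : {set 'I_m.+1} :=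
  [set j : 'I_m.+1 | if (s <= i)%N then (s <= j < i)%N
                     else (s <= j)%N || (j < i)%N].

(** The change of the back arc value between consecutive tails; see
    back_poly_ordS. *)
Definition gain (j : 'I_m.+1) : {poly R} := inflow_poly (pi j) - outflow_poly j.

(** The value of the arc from i to pi (i - 1); it is 0 at i = s, where that arc
    is non-basic. *)
Definition back_poly (i : 'I_m.+1) : {poly R} := \sum_(j in cyc_prefix i) gain j.

Definition forth_poly (i : 'I_m.+1) : {poly R} := outflow_poly i - back_poly i.

Definition basic_x (beta : R) (i j : 'I_m.+1) : R :=
  (j == pi i)%:R * (forth_poly i).[beta]
  + (j == pi (ord_pred i))%:R * (back_poly i).[beta].

Definition basic_y (beta : R) (i : 'I_m.+1) : R :=
  (outflow_poly i).[beta] - beta ^+ m.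

Hypothesis adm : admissible s pi L U.

Lemma adm_pos : (0 < m)%N.
Proof.
case: adm => s0 _ _ _ _; rewrite lt0n; apply: contra_neq s0 => m0.
by apply: val_inj => /=; have := ltn_ord s; rewrite {2}m0; case: (val s).
Qed.

Lemma val_ordS (i : 'I_m.+1) : val (ordS i) = if val i == m then 0%N else i.+1.
Proof.
rewrite /=; case: eqP => [-> | im]; first by rewrite modnn.
by rewrite modn_small // ltnS ltn_neqAle -ltnS ltn_ord andbT; apply/eqP.
Qed.

Lemma ord_pred_neq (i : 'I_m.+1) : ord_pred i != i.
Proof.
apply/eqP => h; have := congr1 val (ord_predK i); rewrite h val_ordS.
by have := adm_pos; case: eqP => [->|_] m0 => [e|/eqP]; [lia|rewrite gtn_eqF].
Qed.

Lemma ordS_eq_s (i : 'I_m.+1) : (ordS i == s) = (i == ord_pred s).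
Proof. by apply/eqP/eqP => [<- | ->]; rewrite ?ordSK ?ord_predK. Qed.

Lemma pi_pred_s : pi (ord_pred s) = s.
Proof.
by case: adm => _ _ succ _ _; have := succ (ord_pred s);
  rewrite eqxx ord_predK => /eqP.
Qed.

Lemma pi_eq_s i : (pi i == s) = (i == ord_pred s).
Proof. by rewrite -{1}pi_pred_s (inj_eq perm_inj). Qed.

Lemma mem_LU i : i != ord0 -> i != s -> (i \in U) = (i \notin L).
Proof.
case: adm => _ _ _ dLU cLU i0 si.
have := finset.in_setC i [set ord0; s]; rewrite -cLU !inE (negbTE i0) (negbTE si).
by case iL: (i \in L) => /=; first rewrite (disjointFr dLU iL).
Qed.

Lemma ord0_notin : (ord0 \in L = false) * (ord0 \in U = false).
Proof.
case: adm => _ _ _ _ cLU; have := finset.in_setC ord0 [set ord0; s].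
by rewrite -cLU !inE eqxx /= => /norP[/negbTE-> /negbTE->].
Qed.

Lemma s_notin : (s \in L = false) * (s \in U = false).
Proof.
case: adm => _ _ _ _ cLU; have := finset.in_setC s [set ord0; s].
by rewrite -cLU !inE eqxx orbT /= => /norP[/negbTE-> /negbTE->].
Qed.

Lemma inflowL i : i \in L -> inflow_poly i = 'X^(m.-1).
Proof.
by rewrite /inflow_poly; case: eqP => [->|_ ->//]; rewrite s_notin.
Qed.

Lemma inflowU i : i \in U -> inflow_poly i = 1.
Proof.
rewrite /inflow_poly; case: eqP => [->|_ iU]; first by rewrite s_notin.
by case: adm => _ _ _ dLU _; rewrite (disjointFl dLU iU) iU.
Qed.

Lemma inflow0 : inflow_poly ord0 = 'X^m.
Proof.
by rewrite /inflow_poly eq_sym; case: adm => /negbTE-> _ _ _ _;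
  rewrite !ord0_notin.
Qed.

Lemma outflowL i : i \in L -> outflow_poly i = 'X^m.
Proof.
move=> iL; rewrite /outflow_poly; case: eqP iL => [->|_ iL].
  by rewrite ord0_notin.
by rewrite inflowL // -exprS prednK // adm_pos.
Qed.

Lemma outflowU i : i \in U -> outflow_poly i = 'X.
Proof.
move=> iU; rewrite /outflow_poly; case: eqP iU => [->|_ iU].
  by rewrite ord0_notin.
by rewrite inflowU // mulr1.
Qed.

Lemma card_LU : (#|L| + #|U| = m.-1)%N.
Proof.
case: adm => s0 _ _ dLU cLU.
have := cardsC [set ord0; s]; rewrite -cLU cards2 eq_sym s0 card_ord.
by rewrite cardsU disjoint_setI0 // cards0 subn0 => -[h]; rewrite -[in RHS]h.
Qed.

Lemma sum_nodes (F : 'I_m.+1 -> {poly R}) :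
  \sum_i F i = F ord0 + F s + \sum_(i in L) F i + \sum_(i in U) F i.
Proof.
case: adm => s0 _ _ dLU cLU.
rewrite (bigID (mem (L :|: U))) /= (eq_bigl [predU L & U]) => [|i]; last by rewrite !inE.
rewrite bigU //= addrC addrA; do 2 congr (_ + _).
rewrite (bigD1 ord0) /=; last by rewrite cLU !inE eqxx.
rewrite (bigD1 s) /=; last by rewrite cLU !inE eqxx orbT s0.
rewrite big1 ?addr0 // => i; rewrite cLU !inE negb_or.
by case: (i == ord0); case: (i == s).
Qed.

(** Both the inflows and the outflows add up to 1 + X + ... + X^m; this is where
    the choice of inflow_poly s enters. *)
Lemma sum_gain : \sum_i gain i = 0.
Proof.
have e : \sum_i inflow_poly (pi i) = \sum_i inflow_poly i.
  by rewrite [RHS](reindex_perm pi).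
rewrite sumrB {}e.
apply/eqP; rewrite subr_eq0; apply/eqP.
have s0 : s != ord0 by case: adm.
rewrite !sum_nodes (eq_bigr _ inflowL) (eq_bigr _ inflowU).
rewrite (eq_bigr _ outflowL) (eq_bigr _ outflowU) inflow0 !sumr_const.
rewrite /outflow_poly eqxx (negbTE s0) /inflow_poly eqxx.
move: #|_| #|_| adm_pos => l u; case: m => // m' _ /=.
set S := \sum_(i < _) _.
have : 'X^(m'.+1) + S = 1 + 'X * S.
  transitivity (\sum_(i < m'.+2) 'X^i : {poly R}).
    by rewrite big_ord_recr addrC.
  rewrite big_ord_recl mulr_sumr; congr (_ + _).
  by apply: eq_bigr => i _; rewrite -exprS.
rewrite !exprS => e.
by rewrite -[LHS]addr0 -[in LHS](subrr (1 + 'X * S)) -{2}e; ring.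
Qed.

Lemma back_poly_s : back_poly s = 0.
Proof. by rewrite /back_poly big_pred0 // => j; rewrite inE leqnn; lia. Qed.

(** The sum over all nodes but s - 1 is the opposite of the term at s - 1, as the
    gains add up to 0. *)
Lemma back_poly_pred_s :
  back_poly (ord_pred s) = outflow_poly (ord_pred s) - inflow_poly s.
Proof.
have -> : outflow_poly (ord_pred s) - inflow_poly s = - gain (ord_pred s).
  by rewrite /gain pi_pred_s opprB.
have := sum_gain; rewrite (bigD1 (ord_pred s)) //= => /eqP.
rewrite addr_eq0 => /eqP ->; rewrite opprK; apply: eq_bigl => j.
have e := val_ordS (ord_pred s); rewrite ord_predK in e.
rewrite inE; move: (ord_pred s) e => a e.
rewrite (_ : (j == a) = (j == a :> nat)) //.
have := ltn_ord j; have := ltn_ord a; have := ltn_ord s.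
by move: e => /=; case: (nat_of_ord a =P m) => /=; case: (leqP s a); lia.
Qed.

Lemma cyc_prefix_ordS i : i != ord_pred s ->
  cyc_prefix (ordS i) = i |: cyc_prefix i.
Proof.
move=> ns; apply/setP => j; rewrite !inE (_ : (j == i) = (j == i :> nat)) //.
have : (ordS i != s :> nat) by rewrite (inj_eq val_inj) ordS_eq_s.
have -> : nat_of_ord (ordS i) = if i == m :> nat then 0%N else i.+1.
  exact: val_ordS.
have := ltn_ord j; have := ltn_ord i; have := ltn_ord s.
by case: (nat_of_ord i =P m) => im /= ? ? ? ?; case: ifP; case: ifP; lia.
Qed.

Lemma notin_cyc_prefix i : i \notin cyc_prefix i.
Proof. by rewrite inE; case: ifP; lia. Qed.

(** The recurrence also closes up at i = s - 1, so that the arcs into every node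
    pi i carry the prescribed inflow. *)
Lemma back_poly_ordS i : back_poly (ordS i) = back_poly i + gain i.
Proof.
case: (eqVneq i (ord_pred s)) => [->|ns].
  by rewrite ord_predK back_poly_s back_poly_pred_s /gain pi_pred_s; ring.
by rewrite /back_poly cyc_prefix_ordS // big_setU1 ?notin_cyc_prefix // addrC.
Qed.

Lemma basic_x_diag beta i : basic_x beta i i = 0.
Proof.
case: adm => _ fpf succ _ _; rewrite /basic_x eq_sym (negbTE (fpf i)) mul0r add0r.
have := succ (ord_pred i); rewrite ord_predK eq_sym => ->.
case: (eqVneq i s) => [->|ns]; first by rewrite back_poly_s horner0 mulr0.
by rewrite (inj_eq (can_inj (@ord_predK _))) (negbTE ns) mul0r.
Qed.

Lemma sum_delta (I : finType) (i : I) (F : I -> R) :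
  \sum_j (j == i)%:R * F j = F i.
Proof.
rewrite (bigD1 i) //= eqxx mul1r big1 ?addr0 // => j /negbTE ->.
by rewrite mul0r.
Qed.

Lemma outflow_basic_x beta i : outflow (basic_x beta) i = (outflow_poly i).[beta].
Proof.
transitivity (\sum_j basic_x beta i j).
  by rewrite [RHS](bigD1 i) //= basic_x_diag add0r.
rewrite big_split /= (sum_delta (pi i) (fun=> _)).
by rewrite (sum_delta (pi (ord_pred i)) (fun=> _)) -hornerD subrK.
Qed.

Lemma inflow_basic_x beta i : inflow (basic_x beta) i = (inflow_poly i).[beta].
Proof.
transitivity (\sum_j basic_x beta j i).
  by rewrite [RHS](bigD1 i) //= basic_x_diag add0r.
rewrite -(permKV pi i); set k := (pi^-1)%g i.
rewrite big_split /=.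
rewrite (eq_bigr (fun j => (j == k)%:R * (forth_poly j).[beta])) => [|j _]; last first.
  by rewrite (inj_eq perm_inj) eq_sym.
rewrite sum_delta (eq_bigr (fun j => (j == ordS k)%:R * (back_poly j).[beta])).
  rewrite sum_delta -hornerD back_poly_ordS /forth_poly /gain.
  by congr (_.[_]); ring.
move=> j _; rewrite (inj_eq perm_inj); congr (_%:R * _).
by congr nat_of_bool; apply/eqP/eqP => ->; rewrite ?ordSK ?ord_predK.
Qed.

Lemma basic_solution_poly beta : basic_solution beta s pi L U
  (basic_x beta) (basic_y beta).
Proof.
split.
- move=> i j; rewrite negb_or negb_and negbK => /andP[/negbTE j1].
  rewrite /basic_x j1 mul0r add0r => /orP[/eqP->|/negbTE->]; last by rewrite mul0r.
  by rewrite back_poly_s horner0 mulr0.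
- by move=> i iL; rewrite /basic_y outflowL // hornerXn subrr.
- by move=> i iU; rewrite /basic_y outflowU // hornerX.
split.
- rewrite outflow_basic_x inflow_basic_x inflow0 /outflow_poly eqxx.
  by rewrite hornerXn hornerC exprS.
- move=> i i0; rewrite outflow_basic_x inflow_basic_x /outflow_poly.
  by rewrite (negbTE i0) hornerM hornerX subrr.
- by rewrite outflow_basic_x /outflow_poly eqxx hornerC.
- by move=> i i0; rewrite outflow_basic_x /basic_y opprB addrC subrK.
Qed.

Definition poly_bounds (beta : R) : Prop :=
  [/\ beta ^+ m <= (outflow_poly s).[beta] <= beta,
      forall i, 0 <= (forth_poly i).[beta]
    & forall i, 0 <= (back_poly i).[beta]].

Lemma WH_bounds_poly beta : 0 < beta < 1 ->
  (WH_bounds beta (basic_x beta) (basic_y beta) <-> poly_bounds beta).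
Proof.
move=> /andP[b0 b1]; have [s0 fpf _ _ _] := adm; split.
  move=> [hy hx].
  have back i : 0 <= (back_poly i).[beta].
    case: (eqVneq i s) => [->|ns]; first by rewrite back_poly_s horner0.
    have := hx i (pi (ord_pred i)); rewrite /basic_x eqxx mul1r.
    rewrite (inj_eq perm_inj) (negbTE (ord_pred_neq i)) mul0r add0r; apply.
    have [_ _ succ _ _] := adm.
    have := succ (ord_pred i); rewrite ord_predK eq_sym => ->.
    by rewrite (inj_eq (can_inj (@ord_predK _))).
  split=> //.
    have := hy s s0; rewrite /basic_y => /andP[h1 h2].
    by rewrite -subr_ge0 h1; lra.
  move=> i; have := hx i (pi i); rewrite eq_sym fpf /basic_x eqxx mul1r.
  by rewrite (inj_eq perm_inj) eq_sym (negbTE (ord_pred_neq i)) mul0r addr0; apply.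
move=> [hs hf hb]; split=> [i i0|i j _]; last first.
  by rewrite /basic_x addr_ge0 // mulr_ge0.
have bm : beta ^+ m <= beta.
  by rewrite -[leRHS]expr1 ler_wiXn2l ?adm_pos // ltW.
rewrite /basic_y; case: (eqVneq i s) => [->|ns].
  by case/andP: hs => h1 h2; rewrite subr_ge0 h1 lerD2r.
case iL: (i \in L); first by rewrite outflowL // hornerXn subrr lexx subr_ge0.
by rewrite outflowU ?mem_LU ?iL // hornerX lexx subr_ge0 bm.
Qed.

(** By uniqueness of the basic solution, feasibility is a sign condition on the
    polynomials above. *)
Lemma feasible_poly_bounds :
  feasible_basis R s pi L U <-> \forall beta \near at_left (1 : R), poly_bounds beta.
Proof.
split=> h; near=> beta.
  have b01 : 0 < beta < 1.
    by apply/andP; split; near: beta; [exact: nbhs_left_gt|exact: nbhs_left_lt].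
  have [x [y [sol bnd]]] : exists x y,
      basic_solution beta s pi L U x y /\ WH_bounds beta x y by near: beta.
  apply/WH_bounds_poly => //.
  have [ex ey] := basic_solution_unique b01 adm sol (basic_solution_poly beta).
  case: bnd => hy hx; split=> [i i0|i j ij]; first by rewrite -ey // hy.
  by rewrite -ex hx.
have b01 : 0 < beta < 1.
  by apply/andP; split; near: beta; [exact: nbhs_left_gt|exact: nbhs_left_lt].
exists (basic_x beta), (basic_y beta); split; first exact: basic_solution_poly.
by apply/WH_bounds_poly => //; near: beta.
Unshelve. all: by end_near. Qed.

(** * First-order behaviour at 1 *)

Lemma horner1_inflow i : (inflow_poly i).[1] = 1.
Proof.
rewrite /inflow_poly; case: eqP => _; last first.
  by case: (i \in L); last case: (i \in U); rewrite ?horner1_Xn ?hornerC.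
rewrite !hornerD !hornerN horner_sum !hornerMn hornerC horner1_Xn.
rewrite (eq_bigr (fun=> 1)) => [|j _]; last by rewrite horner1_Xn.
rewrite sumr_const card_ord -addrA -opprD -mulrnDr card_LU.
by rewrite -mulrnBr ?leq_pred // -{1}(prednK adm_pos) subSnn.
Qed.

Lemma horner1_outflow i : (outflow_poly i).[1] = 1.
Proof.
rewrite /outflow_poly; case: eqP => _; first by rewrite hornerC.
by rewrite hornerM hornerX mul1r horner1_inflow.
Qed.

Lemma horner1_back i : (back_poly i).[1] = 0.
Proof.
rewrite /back_poly horner_sum big1 // => j _.
by rewrite /gain hornerD hornerN horner1_inflow horner1_outflow subrr.
Qed.

Lemma slope_inflowL i : i \in L -> slope (inflow_poly i) = m.-1%:R.
Proof. by move=> iL; rewrite inflowL // slopeXn. Qed.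

Lemma slope_inflowU i : i \in U -> slope (inflow_poly i) = 0.
Proof. by move=> iU; rewrite inflowU // slope1. Qed.

Lemma slope_inflow0 : slope (inflow_poly ord0) = m%:R.
Proof. by rewrite inflow0 slopeXn. Qed.

Lemma slope_outflow i : i != ord0 ->
  slope (outflow_poly i) = 1 + slope (inflow_poly i).
Proof. by move=> i0; rewrite /outflow_poly (negbTE i0) slopeXM horner1_inflow. Qed.

Lemma slope_outflow0 : slope (outflow_poly ord0) = 0.
Proof. by rewrite /outflow_poly eqxx slope1. Qed.

Lemma slope_inflow_s :
  slope (inflow_poly s) * 2 = m.-1%:R * (m%:R - 2 * #|L|%:R).
Proof.
have sum_nat n : (\sum_(j < n) j%:R : R) * 2 = n%:R * n.-1%:R.
  elim: n => [|n IH]; first by rewrite big_ord0 !mul0r.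
  rewrite big_ord_recr mulrDl IH /=.
  by case: n {IH} => [|n] /=; rewrite ?mulr0 ?mul0r ?addr0 // -!natr1; ring.
rewrite /inflow_poly eqxx !slopeB slope_sum.
rewrite (eq_bigr (fun j : 'I_m => (nat_of_ord j)%:R)) => [|j _]; last exact: slopeXn.
rewrite /slope !derivMn !hornerMn -!/(slope _) slopeXn slope1 mul0rn subr0.
by rewrite mulrBl sum_nat -mulr_natr; ring.
Qed.

(** Pairing b^i with b^(n-i). *)
Lemma geometric_gap n (b : R) :
  n.+1%:R * (1 + b ^+ n) - 2 * \sum_(i < n.+1) b ^+ i
  = \sum_(i < n.+1) (1 - b ^+ i) * (1 - b ^+ (n - i)).
Proof.
have rev : \sum_(i < n.+1) b ^+ i = \sum_(i < n.+1) b ^+ (n - i).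
  by rewrite (reindex_inj rev_ord_inj); apply: eq_bigr => i _ /=; rewrite subSS.
rewrite (mulr_natl _ 2) mulr2n {2}rev -big_split /=.
have -> : n.+1%:R * (1 + b ^+ n) = \sum_(i < n.+1) (1 + b ^+ n).
  by rewrite sumr_const card_ord mulr_natl.
rewrite -sumrB.
apply: eq_bigr => i _; have := ltn_ord i; rewrite ltnS => /subnKC e.
by rewrite -[in b ^+ n]e exprD; ring.
Qed.

Lemma geometric_le n (b : R) : 0 <= b <= 1 ->
  2 * \sum_(i < n.+1) b ^+ i <= n.+1%:R * (1 + b ^+ n).
Proof.
move=> /andP[b0 b1]; rewrite -subr_ge0 geometric_gap sumr_ge0 // => i _.
by rewrite mulr_ge0 // subr_ge0 exprn_ile1.
Qed.

Lemma geometric_lt n (b : R) : 0 <= b < 1 -> (1 < n)%N ->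
  2 * \sum_(i < n.+1) b ^+ i < n.+1%:R * (1 + b ^+ n).
Proof.
move=> /andP[b0 b1]; case: n => [|[|n]] // _; rewrite -subr_gt0 geometric_gap.
rewrite (bigD1 (lift ord0 ord0)) //= ltr_wpDr //.
  apply: sumr_ge0 => i _; rewrite mulr_ge0 // subr_ge0 exprn_ile1 //; exact: ltW.
by rewrite mulr_gt0 // subr_gt0 exprn_ilt1.
Qed.

(** With three nodes, pi s must be s - 1 and then no value is left for
    pi (s + 1). *)
Lemma adm_neq2 : m != 2%N.
Proof.
apply/eqP => m2; have [s0 fpf succ _ _] := adm.
have cover x : [|| x == s, x == ordS s | x == ord_pred s].
  have eS := val_ordS s; have eP := val_ordS (ord_pred s).
  rewrite ord_predK in eP.
  have := ltn_ord x; have := ltn_ord s; have := ltn_ord (ord_pred s).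
  move: (ordS s) eS (ord_pred s) eP s0 => a ea p ep; rewrite -!val_eqE /=.
  by move: ea ep => /=; case: eqP => ? ?; case: eqP => ? ?; lia.
have Ss : ordS s != s by rewrite ordS_eq_s eq_sym ord_pred_neq.
have pis : pi s = ord_pred s.
  have := cover (pi s); rewrite (negbTE (fpf s)) succ eq_sym.
  by rewrite (negbTE (ord_pred_neq s)) => /eqP.
have SP : ordS s != ord_pred s.
  by rewrite -pis eq_sym succ eq_sym ord_pred_neq.
have := cover (pi (ordS s)); rewrite pi_eq_s (negbTE SP) (negbTE (fpf _)) /=.
by rewrite -pis (inj_eq perm_inj) (negbTE Ss).
Qed.

Lemma slope_inflow_s_odd k : m = (2 * k)%N ->
  slope (inflow_poly s) = m.-1%:R * (k%:R - #|L|%:R).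
Proof.
move=> mk; have := slope_inflow_s; rewrite [in m%:R]mk natrM => h; lra.
Qed.

(** At first order the bounds on y_s leave the two values k and k - 1; for k - 1
    the lower bound becomes an equality at first order, and strict convexity of
    the powers breaks the tie. *)
Lemma card_L_of_bounds k : m = (2 * k)%N -> (2 < m)%N ->
  (\forall beta \near at_left (1 : R), poly_bounds beta) -> #|L| = k.
Proof.
move=> mk m2 bnd.
have sl := slope_inflow_s_odd mk.
have s0 : s != ord0 by case: adm.
have m1 : 0 < m.-1%:R :> R by rewrite ltr0n; lia.
have up : slope ('X - outflow_poly s) <= 0.
  apply: slope_le0_of_near; first by rewrite hornerD hornerN hornerX horner1_outflow subrr.
  near=> b; have [/andP[_ h] _ _] : poly_bounds b by near: b.
  by rewrite hornerD hornerN hornerX subr_ge0.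
have lo : slope (outflow_poly s - 'X^m) <= 0.
  apply: slope_le0_of_near.
    by rewrite hornerD hornerN horner1_Xn horner1_outflow subrr.
  near=> b; have [/andP[h _] _ _] : poly_bounds b by near: b.
  by rewrite hornerD hornerN hornerXn subr_ge0.
move: up lo; rewrite !slopeB (slopeXn R 1) slopeXn slope_outflow // sl => up lo.
have Lk : (#|L| <= k)%N.
  rewrite -(ler_nat R) -subr_ge0 -(pmulr_rge0 _ m1); lra.
have kL : (k <= #|L|.+1)%N.
  rewrite -(ler_nat R) -natr1 -subr_ge0 -(pmulr_rge0 _ m1).
  have : m%:R = m.-1%:R + 1 :> R by rewrite natr1 prednK // adm_pos.
  lra.
apply/eqP; rewrite eqn_leq Lk leqNgt; apply/negP => Lk'.
have {Lk' Lk kL} Lk : k = #|L|.+1 by lia.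
have Uk : #|U| = k by have := card_LU; lia.
near (at_left (1 : R)) => b.
have b0 : 0 < b by near: b; exact: nbhs_left_gt.
have b1 : b < 1 by near: b; exact: nbhs_left_lt.
have [/andP[h _] _ _] : poly_bounds b by near: b.
move: h; rewrite /outflow_poly (negbTE s0) hornerM hornerX -{1}(prednK adm_pos).
rewrite exprS ler_pM2l // /inflow_poly eqxx !hornerD !hornerN horner_sum.
rewrite !hornerMn hornerC hornerXn Uk.
rewrite (eq_bigr (fun j : 'I_m => b ^+ j)) => [|j _]; last by rewrite hornerXn.
(* The lower bound on y_s now reads k (1 + b^(m-1)) <= 1 + b + ... + b^(m-1). *)
have m1' : (1 < m.-1)%N by lia.
have bb : 0 <= b < 1 by rewrite ltW.
have mR : m%:R = 2 * k%:R :> R by rewrite mk natrM.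
have := geometric_lt bb m1'; rewrite prednK ?adm_pos // mR.
rewrite -(mulr_natr _ #|L|) Lk -[#|L|.+1%:R]natr1.
by move: (\sum_(i < m) _) (b ^+ _) (#|L|%:R) => {}S q l; lra.
Unshelve. all: by end_near. Qed.

(** * Feasible bases with |L| = k and the index i^* *)

Hypothesis mL : m = (2 * #|L|)%N.
Hypothesis m2 : (2 < m)%N.

Lemma slope_inflow_s_eq0 : slope (inflow_poly s) = 0.
Proof. by rewrite (slope_inflow_s_odd mL) subrr mulr0. Qed.

Lemma slope_outflow_s_eq1 : slope (outflow_poly s) = 1.
Proof. by rewrite slope_outflow ?slope_inflow_s_eq0 ?addr0 //; case: adm. Qed.

Lemma inflow_s_le1 b : 0 <= b <= 1 -> (inflow_poly s).[b] <= 1.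
Proof.
move=> bb; rewrite /inflow_poly eqxx !hornerD !hornerN horner_sum.
rewrite !hornerMn hornerC hornerXn.
rewrite (eq_bigr (fun j : 'I_m => b ^+ j)) => [|j _]; last by rewrite hornerXn.
have := geometric_le m.-1 bb; rewrite prednK ?adm_pos //.
have mR : m%:R = 2 * #|L|%:R :> R by rewrite [in LHS]mL natrM.
have uR : #|U|%:R = #|L|%:R - 1 :> R.
  have /eqP := card_LU; rewrite -(eqr_nat R) natrD.
  have : m%:R = m.-1%:R + 1 :> R by rewrite natr1 prednK // adm_pos.
  by move=> h /eqP; lra.
rewrite mR -[b ^+ m.-1 *+ _]mulr_natr uR.
by move: (\sum_(i < m) _) (b ^+ _) (#|L|%:R) => S q l; lra.
Qed.

Lemma back_slope_le0 i :
  (\forall beta \near at_left (1 : R), poly_bounds beta) -> slope (back_poly i) <= 0.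
Proof.
move=> bnd; apply: slope_le0_of_near; first exact: horner1_back.
by near=> b; have [_ _] : poly_bounds b by near: b.
Unshelve. all: by end_near. Qed.

Lemma back_poly_Ss : back_poly (ordS s) = gain s.
Proof. by rewrite back_poly_ordS back_poly_s add0r. Qed.

Lemma pi_s_in_U :
  (\forall beta \near at_left (1 : R), poly_bounds beta) -> pi s \in U.
Proof.
move=> /(@back_slope_le0 (ordS s)); rewrite back_poly_Ss slopeB slope_outflow_s_eq1.
have [s0 fpf _ _ _] := adm.
case: (eqVneq (pi s) ord0) => [->|p0].
  by rewrite slope_inflow0 subr_le0 (ler_nat _ _ 1); lia.
case pL: (pi s \in L); last by rewrite mem_LU // pL.
by rewrite slope_inflowL // subr_le0 (ler_nat _ _ 1); lia.
Qed.

Lemma pred_s_eq0 :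
  (\forall beta \near at_left (1 : R), poly_bounds beta) -> ord_pred s = ord0.
Proof.
move=> /(@back_slope_le0 (ord_pred s)).
rewrite back_poly_pred_s slopeB slope_inflow_s_eq0 subr0.
case: (eqVneq (ord_pred s) ord0) => // p0; rewrite slope_outflow //.
case pL: (ord_pred s \in L).
  by rewrite slope_inflowL // -(natrD _ 1) lern0.
rewrite slope_inflowU ?mem_LU ?pL ?ord_pred_neq // addr0.
by rewrite ler10.
Qed.

Hypothesis piU : pi s \in U.
Hypothesis s1 : ord_pred s = ord0.

Lemma val_s : nat_of_ord s = 1%N.
Proof.
by have := val_ordS ord0; rewrite -{1}s1 ord_predK /= eq_sym gtn_eqF // adm_pos.
Qed.

(** The contribution of j to N_UL + N_UR + N_RL - N_LU. *)
Definition excess (j : 'I_m.+1) : R :=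
  (j \in W s pi U L)%:R + (j \in W s pi U (Rset m))%:R
  + (j \in W s pi (Rset m) L)%:R - (j \in W s pi L U)%:R.

(** The slopes of inflows are m - 1, 0, m on L, U, {1} and those of outflows are
    m, 1 on L, U; this formula captures all six cases at once. *)
Lemma slope_gain j : j != s -> j != ord0 ->
  slope (gain j) = -1 + (pi j == ord0)%:R + m.-1%:R * excess j.
Proof.
move=> js j0; rewrite slopeB slope_outflow // /excess !inE js (negbTE j0) /=.
have mE : m%:R = m.-1%:R + 1 :> R by rewrite natr1 prednK // adm_pos.
have ps : pi j != s by rewrite pi_eq_s s1.
case jL: (j \in L); last have jU : j \in U by rewrite mem_LU ?jL.
- rewrite (slope_inflowL jL) (mem_LU j0 js) jL /=.
  case: (eqVneq (pi j) ord0) => [->|p0].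
    by rewrite slope_inflow0 !ord0_notin /=; lra.
  case pL: (pi j \in L); first by rewrite slope_inflowL // mem_LU // pL /=; lra.
  by rewrite slope_inflowU mem_LU ?pL //=; lra.
- rewrite (slope_inflowU jU) jU /=.
  case: (eqVneq (pi j) ord0) => [->|p0].
    by rewrite slope_inflow0 !ord0_notin /=; lra.
  case pL: (pi j \in L); first by rewrite slope_inflowL // /=; lra.
  by rewrite slope_inflowU ?mem_LU ?pL //=; lra.
Qed.

Lemma cyc_prefix_interval (i : 'I_m.+1) : (s < i)%N ->
  cyc_prefix (ordS i) = s |: cyc_interval s i.
Proof.
move=> si; apply/setP => j; rewrite /cyc_interval si !inE.
rewrite (_ : (j == s) = (j == s :> nat)) //.
have -> : nat_of_ord (ordS i) = if i == m :> nat then 0%N else i.+1.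
  exact: val_ordS.
have := ltn_ord j; have := ltn_ord i; rewrite val_s; rewrite val_s in si.
by case: (nat_of_ord i =P m) => im /= ? ?; lia.
Qed.

Lemma sum_mem (A B : {set 'I_m.+1}) :
  \sum_(j in A) (j \in B)%:R = #|A :&: B|%:R :> R.
Proof.
rewrite -sum1_card natr_sum (eq_bigl (fun j => (j \in A) && (j \in B))).
  by rewrite big_mkcondr; apply: eq_bigr => j _; case: (j \in B).
by move=> j; rewrite inE.
Qed.

(** This is 0 or 1, as pi is injective. *)
Definition hits0 (i : 'I_m.+1) : nat := #|cyc_interval s i :&: [set j | pi j == ord0]|.

Lemma slope_back_ordS (i : 'I_m.+1) : (s < i)%N ->
  slope (back_poly (ordS i)) =
  -1 - #|cyc_interval s i|%:R + (hits0 i)%:R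
  + m.-1%:R * ((N s pi U L i + N s pi U (Rset m) i + N s pi (Rset m) L i)%N%:R
               - (N s pi L U i)%:R).
Proof.
move=> si; rewrite /back_poly cyc_prefix_interval //.
have inI j : j \in cyc_interval s i -> (s < j <= i)%N.
  by rewrite /cyc_interval si inE.
rewrite big_setU1 /=; last by apply/negP => /inI; rewrite ltnn.
rewrite slopeD slope_sum slopeB slope_outflow_s_eq1 slope_inflowU // sub0r.
rewrite (eq_bigr (fun j => -1 + (j \in [set j | pi j == ord0])%:R
                             + m.-1%:R * excess j)); last first.
  move=> j /inI /andP[sj _]; rewrite inE slope_gain //.
    by rewrite -val_eqE gtn_eqF.
  by rewrite -val_eqE /= -lt0n (leq_trans _ sj).
rewrite !big_split /= sumr_const -mulr_sumr /excess sum_mem.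
rewrite !(big_split, sumrN) /= !sum_mem -/(N _ _ _ _ _) !natrD.
by rewrite /hits0 mulNrn -/(N _ _ _ _ _); ring.
Qed.

Definition pre0 : 'I_m.+1 := (pi^-1)%g ord0.

Lemma pi_pre0 j : (pi j == ord0) = (j == pre0).
Proof. by rewrite /pre0 -{1}(permKV pi ord0) (inj_eq perm_inj). Qed.

Lemma ordS_max : ordS (ord_max : 'I_m.+1) = ord0.
Proof. by apply: val_inj; rewrite val_ordS eqxx. Qed.

(** Node n is excluded because pi n = 1 = n + 1 would make n = s - 1 = 1. *)
Lemma pre0_inner : pre0 \in ~: [set ord0; s; ord_max].
Proof.
have [_ fpf succ _ _] := adm.
rewrite !inE !negb_or (eq_sym pre0 ord0) (eq_sym pre0 s) (eq_sym pre0 ord_max).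
rewrite -!pi_pre0 fpf /=; apply/andP; split.
  by apply/eqP => h; have := piU; rewrite h ord0_notin.
rewrite -ordS_max succ s1 -val_eqE /=; have := adm_pos; lia.
Qed.

Lemma card_inner : #|~: [set ord0; s; ord_max]| = m.-2.
Proof.
have := cardsC [set ord0; s; ord_max]; rewrite card_ord.
rewrite finset.setUC cardsU1 cards2 !inE -!val_eqE /= val_s.
by rewrite (_ : (m == 0) || (m == 1) = false) /=; lia.
Qed.

(** Either I(i) has fewer than the m - 2 nodes different from 1, s and n, or it
    contains all of them, hence pre0 as well. *)
Lemma hits0_bound (i : 'I_m.+1) : (s < i < m)%N ->
  (#|cyc_interval s i| < m.-2 + hits0 i)%N.
Proof.
move=> /andP[si im]; rewrite -card_inner.
have sub : cyc_interval s i \subset ~: [set ord0; s; ord_max].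
  apply/fintype.subsetP => j; rewrite /cyc_interval si !inE -!val_eqE /= val_s; lia.
case pI: (pre0 \in cyc_interval s i).
  have : (0 < hits0 i)%N.
    by apply/card_gt0P; exists pre0; rewrite !inE pI pi_pre0 eqxx.
  by move=> hit; rewrite -addn1 leq_add ?subset_leq_card.
rewrite (leq_trans _ (leq_addr _ _)) // proper_card // properE sub.
by apply/subsetPn; exists pre0; rewrite ?pre0_inner ?pI.
Qed.

Lemma hits0_le (i : 'I_m.+1) : (hits0 i <= #|cyc_interval s i|)%N.
Proof. exact/subset_leq_card/subsetIl. Qed.

Definition rises (i : 'I_m.+1) : nat :=
  (N s pi U L i + N s pi U (Rset m) i + N s pi (Rset m) L i)%N.

(** The back arc at node 1 is 1 - c_s, whose slope is 0; comparing with
    slope_back_ordS at i = n gives the count. *)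
Lemma balance_max : rises ord_max = (N s pi L U ord_max).+1.
Proof.
have smax : (s < (ord_max : 'I_m.+1))%N by rewrite val_s /=; lia.
have := slope_back_ordS smax; rewrite -/(rises _).
rewrite ordS_max -s1 back_poly_pred_s slopeB s1 slope_outflow0.
rewrite slope_inflow_s_eq0 subrr.
have cE : cyc_interval s ord_max = ~: [set ord0; s].
  apply/setP => j; rewrite /cyc_interval smax !inE -!val_eqE /= val_s.
  by have := ltn_ord j; lia.
have -> : #|cyc_interval s ord_max| = m.-1.
  have [s0 _ _ _ _] := adm.
  have := cardsC [set ord0; s]; rewrite -cE cards2 eq_sym s0 card_ord => /= -[].
  by move=> h; rewrite -[in RHS]h.
have -> : hits0 ord_max = 1%N.
  rewrite /hits0 cE -(cards1 pre0); congr #|pred_of_set _|.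
  apply/setP => j; rewrite !inE pi_pre0 negb_or.
  case: (j =P pre0) => [->|]; rewrite ?andbF //.
  by have := pre0_inner; rewrite !inE !negb_or => /andP[/andP[-> ->] _].
have m1 : m.-1%:R != 0 :> R by rewrite pnatr_eq0; lia.
move=> h; apply/eqP; rewrite -(eqr_nat R) -natr1 -subr_eq0 -(mulrI_eq0 _ (mulfI m1)).
by apply/eqP; move: h; lra.
Qed.

Lemma slope_back_lt0 (i : 'I_m.+1) : (s < i < m)%N ->
  (rises i <= N s pi L U i)%N -> slope (back_poly (ordS i)) < 0.
Proof.
move=> /andP[si im] d; rewrite slope_back_ordS // -/(rises _).
have := hits0_le i; rewrite -(ler_nat R) => le.
have m1 : 0 <= m.-1%:R :> R by [].
have : (rises i)%:R - (N s pi L U i)%:R <= 0 :> R by rewrite subr_le0 ler_nat.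
by move=> /(mulr_ge0_le0 m1); lra.
Qed.

Lemma slope_back_gt0 (i : 'I_m.+1) : (s < i < m)%N ->
  (0 < slope (back_poly (ordS i))) = (N s pi L U i < rises i)%N.
Proof.
move=> sim; case: ltnP => d; last by apply/negbTE; rewrite -leNgt ltW ?slope_back_lt0.
have := hits0_bound sim; have /andP[si _] := sim.
rewrite slope_back_ordS // -/(rises _) -(ltr_nat R) natrD => bound.
have m2R : m.-1%:R = m.-2%:R + 1 :> R by rewrite natr1 prednK //; lia.
have m1 : 0 <= m.-1%:R :> R by [].
have : 1 <= (rises i)%:R - (N s pi L U i)%:R :> R by rewrite lerBrDl natr1 ler_nat.
by move=> /(ler_wpM2l m1); rewrite mulr1; lra.
Qed.

(** The equation defining i^* holds at n by balance_max, so only the inequalities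
    before n remain. *)
Lemma is_istar_max : is_istar s pi L U ord_max =
  [forall i : 'I_m.+1, (s < i < m)%N ==> (rises i <= N s pi L U i)%N].
Proof.
have smax : (s < (ord_max : 'I_m.+1))%N by rewrite val_s /=; lia.
rewrite /is_istar s1 -!val_eqE /= -/(rises _) balance_max addn1 eqxx.
have -> : (m != s)%N by rewrite val_s; lia.
have -> : (m != 0)%N by lia.
rewrite /=.
apply: eq_forallb => i; rewrite /cyc_interval smax !inE -val_eqE /= val_s.
by congr (_ ==> _); have := ltn_ord i; lia.
Qed.

Lemma is_istar_of_bounds :
  (\forall beta \near at_left (1 : R), poly_bounds beta) ->
  is_istar s pi L U ord_max.
Proof.
move=> bnd; rewrite is_istar_max; apply/forallP => i; apply/implyP => si.
by rewrite leqNgt -slope_back_gt0 // -leNgt back_slope_le0.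
Qed.

(** Strict first-order signs decide every bound except three: y_s <= beta - beta^m
    and b_1 >= 0, both from inflow_s_le1, and b_s = 0. *)
Lemma bounds_of_is_istar : is_istar s pi L U ord_max ->
  \forall beta \near at_left (1 : R), poly_bounds beta.
Proof.
rewrite is_istar_max => /forallP star.
have s0 : s != ord0 by case: adm.
have lo : \forall b \near at_left (1 : R), 0 < (outflow_poly s - 'X^m).[b].
  apply: near_horner_slope.
    by rewrite hornerD hornerN horner1_Xn horner1_outflow subrr.
  by rewrite slopeB slopeXn slope_outflow_s_eq1 subr_lt0 (ltr_nat _ 1); lia.
have forth : \forall b \near at_left (1 : R), forall i, 0 < (forth_poly i).[b].
  apply: filter_forall => i; apply: near_horner_gt0.
  by rewrite hornerD hornerN horner1_back horner1_outflow subr0.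
have back : \forall b \near at_left (1 : R), forall i : 'I_m.+1,
    (s <= i < m)%N -> 0 < (back_poly (ordS i)).[b].
  apply: filter_forall => i; case si: (s <= i < m)%N; last exact: filterE.
  suff : slope (back_poly (ordS i)) < 0.
    move=> sl; have := near_horner_slope (horner1_back _) sl.
    by apply: filterS => b + _.
  case/andP: si; rewrite leq_eqVlt => /orP[/eqP e _|si im]; last first.
    by apply: slope_back_lt0; [rewrite si|have := star i; rewrite si im].
  have <- : s = i by apply: val_inj.
  by rewrite back_poly_Ss slopeB slope_inflowU // slope_outflow_s_eq1 sub0r ltrN10.
near=> b.
have b01 : 0 <= b <= 1.
  by apply/andP; split; apply: ltW; near: b; [exact: nbhs_left_gt|exact: nbhs_left_lt].
have /andP[b0 b1] := b01; have sle1 := inflow_s_le1 b01.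
split.
- apply/andP; split.
    rewrite -subr_ge0 -hornerXn -hornerN -hornerD ltW //; near: b; exact: lo.
  by rewrite /outflow_poly (negbTE s0) hornerM hornerX ler_piMr.
- by move=> i; apply: ltW; move: i; near: b.
- move=> i; rewrite -(ord_predK i); move: (ord_pred i) => {}i.
  case: (eqVneq i ord_max) => [->|im].
    rewrite ordS_max -s1 back_poly_pred_s s1 /outflow_poly eqxx.
    by rewrite hornerD hornerN hornerC subr_ge0.
  case: (eqVneq i ord0) => [->|i0].
    by rewrite -s1 ord_predK back_poly_s horner0.
  have si : (s <= i < m)%N.
    rewrite val_s lt0n; have := ltn_ord i.
    by move: i0 im; rewrite -!val_eqE /=; lia.
  by apply: ltW; move: i si {i0 im}; near: b.
Unshelve. all: by end_near. Qed.

End BasicSolution.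
End FeasibleBases.

Theorem theorem4p2 (R : realType) (k : nat) (s : 'I_(2 * k).+1)
    (pi : {perm 'I_(2 * k).+1}) (L U : {set 'I_(2 * k).+1}) :
  admissible s pi L U ->
  (feasible_basis R s pi L U <->
   [/\ #|U| = (k - 1)%N /\ #|L| = k,
       pi s \in U,
       ord_pred s \in Rset (2 * k)
     & istar s pi L U = Some ord_max]).
Proof.
move=> adm; rewrite feasible_poly_bounds //.
have m2 : (2 < 2 * k)%N by have := adm_neq2 adm; have := adm_pos adm; lia.
split=> [bnd | [[_ Lk] piU s1 star]].
  have Lk := card_L_of_bounds adm erefl m2 bnd.
  have mL : (2 * k = 2 * #|L|)%N by rewrite Lk.
  have piU := pi_s_in_U adm mL m2 bnd.
  have s1 := pred_s_eq0 adm mL bnd.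
  have star := is_istar_of_bounds adm mL m2 piU s1 bnd.
  split=> //; last 2 first.
  - by rewrite s1 /Rset inE.
  - rewrite /istar; case: pickP => [i /is_istar_unique/(_ star) -> //|/(_ ord_max)].
    by rewrite star.
  by split=> //; have := card_LU adm; lia.
have mL : (2 * k = 2 * #|L|)%N by rewrite Lk.
have {}s1 : ord_pred s = ord0 by apply/eqP; move: s1; rewrite /Rset inE.
apply: (bounds_of_is_istar R adm mL m2 piU s1).
by move: star; rewrite /istar; case: pickP => // i ? [<-].
Qed.
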